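(* If $(b,c)\in\{(1,1),(1,2),(1,3),(2,2),(2,3),(2,4),(2,5)\}$, then the quaternion algebra $\mathbb{H}_{\mathbb{Q}}(-b,-c)$ over the field of rational numbers is a division algebra. (Thus all $7$ quaternion algebras obtained in this way are division algebras.)
   Context: $\mathbb{H}_{\mathbb{Q}}(-b,-c)$ is the 4-dimensional associative unital $\mathbb{Q}$-algebra with basis $\{1,e_2,e_3,e_4\}$ and $e_2^2=-b$, $e_3^2=-c$, $e_2e_3=-e_3e_2=e_4$. For $x=x_1+x_2e_2+x_3e_3+x_4e_4$ the norm is $\mathbf{n}(x)=x_1^2+bx_2^2+cx_3^2+bcx_4^2$. The algebra is called a division algebra if $\mathbf{n}(x)=0$ implies $x=0$; otherwise it is called split. *)

(* Defs.v *)
From HB Require Import structures.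
From mathcomp Require Import all_boot all_order all_algebra all_field.
From mathcomp Require Import ring.

Set Implicit Arguments.
Unset Strict Implicit.
Unset Printing Implicit Defensive.

Import GRing.Theory.
Local Open Scope ring_scope.

(* [quat b c] is the quaternion algebra H_Q(-b, -c): the parameters b and c   *)
(* enter with a minus sign in e2^2 and e3^2.  A quaternion                    *)
(* x1 + x2 e2 + x3 e3 + x4 e4 is the row vector (x1, x2, x3, x4).             *)
Definition quat (b c : rat) : Type := 'rV[rat]_4.

HB.instance Definition _ (b c : rat) := Vector.copy (quat b c) 'rV[rat]_4.

Section Quaternions.
Variables b c : rat.
Implicit Types x y z : quat b c.

Definition mkquat (x1 x2 x3 x4 : rat) : quat b c :=
  \row_(i < 4) [:: x1; x2; x3; x4]`_i.

Definition qc1 x : rat := x 0 (@Ordinal 4 0 isT).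
Definition qc2 x : rat := x 0 (@Ordinal 4 1 isT).
Definition qc3 x : rat := x 0 (@Ordinal 4 2 isT).
Definition qc4 x : rat := x 0 (@Ordinal 4 3 isT).

Definition qone : quat b c := mkquat 1 0 0 0.
Definition qe2 : quat b c := mkquat 0 1 0 0.
Definition qe3 : quat b c := mkquat 0 0 1 0.
Definition qe4 : quat b c := mkquat 0 0 0 1.

(* The bilinear extension of the table forced by associativity and            *)
(* e2^2 = -b, e3^2 = -c, e2 e3 = - e3 e2 = e4, namely                         *)
(*   e4^2 = -bc, e3 e4 = c e2 = - e4 e3, e4 e2 = b e3 = - e2 e4.              *)
Definition qmul x y : quat b c :=
  mkquat
    (qc1 x * qc1 y - b * (qc2 x * qc2 y) - c * (qc3 x * qc3 y)
       - b * c * (qc4 x * qc4 y))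
    (qc1 x * qc2 y + qc2 x * qc1 y + c * (qc3 x * qc4 y - qc4 x * qc3 y))
    (qc1 x * qc3 y + qc3 x * qc1 y + b * (qc4 x * qc2 y - qc2 x * qc4 y))
    (qc1 x * qc4 y + qc4 x * qc1 y + (qc2 x * qc3 y - qc3 x * qc2 y)).

Lemma quatP x y :
  qc1 x = qc1 y -> qc2 x = qc2 y -> qc3 x = qc3 y -> qc4 x = qc4 y -> x = y.
Proof.
rewrite /qc1 /qc2 /qc3 /qc4 => h1 h2 h3 h4; apply/rowP.
by case=> [[|[|[|[|//]]]] i4]; rewrite (bool_irrelevance i4 isT).
Qed.

Lemma qc1_mk (x1 x2 x3 x4 : rat) : qc1 (mkquat x1 x2 x3 x4) = x1.
Proof. by rewrite /qc1 mxE. Qed.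
Lemma qc2_mk (x1 x2 x3 x4 : rat) : qc2 (mkquat x1 x2 x3 x4) = x2.
Proof. by rewrite /qc2 mxE. Qed.
Lemma qc3_mk (x1 x2 x3 x4 : rat) : qc3 (mkquat x1 x2 x3 x4) = x3.
Proof. by rewrite /qc3 mxE. Qed.
Lemma qc4_mk (x1 x2 x3 x4 : rat) : qc4 (mkquat x1 x2 x3 x4) = x4.
Proof. by rewrite /qc4 mxE. Qed.
Definition qc_mk := (qc1_mk, qc2_mk, qc3_mk, qc4_mk).

Lemma qc1D x y : qc1 (x + y) = qc1 x + qc1 y. Proof. by rewrite /qc1 mxE. Qed.
Lemma qc2D x y : qc2 (x + y) = qc2 x + qc2 y. Proof. by rewrite /qc2 mxE. Qed.
Lemma qc3D x y : qc3 (x + y) = qc3 x + qc3 y. Proof. by rewrite /qc3 mxE. Qed.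
Lemma qc4D x y : qc4 (x + y) = qc4 x + qc4 y. Proof. by rewrite /qc4 mxE. Qed.
Definition qcD := (qc1D, qc2D, qc3D, qc4D).

Lemma qc1Z a x : qc1 (a *: x) = a * qc1 x. Proof. by rewrite /qc1 mxE. Qed.
Lemma qc2Z a x : qc2 (a *: x) = a * qc2 x. Proof. by rewrite /qc2 mxE. Qed.
Lemma qc3Z a x : qc3 (a *: x) = a * qc3 x. Proof. by rewrite /qc3 mxE. Qed.
Lemma qc4Z a x : qc4 (a *: x) = a * qc4 x. Proof. by rewrite /qc4 mxE. Qed.
Definition qcZ := (qc1Z, qc2Z, qc3Z, qc4Z).

Lemma qmulA : associative qmul.
Proof. by move=> x y z; apply: quatP; rewrite !qc_mk; ring. Qed.
Lemma qmul1q : left_id qone qmul.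
Proof. by move=> x; apply: quatP; rewrite !qc_mk; ring. Qed.
Lemma qmulq1 : right_id qone qmul.
Proof. by move=> x; apply: quatP; rewrite !qc_mk; ring. Qed.
Lemma qmulDl : left_distributive qmul +%R.
Proof. by move=> x y z; apply: quatP; rewrite !(qcD, qc_mk); ring. Qed.
Lemma qmulDr : right_distributive qmul +%R.
Proof. by move=> x y z; apply: quatP; rewrite !(qcD, qc_mk); ring. Qed.
Lemma qone_neq0 : qone != 0.
Proof. by apply/eqP => /(congr1 qc1); rewrite qc_mk /qc1 mxE. Qed.
Lemma qscaleAl a x y : a *: qmul x y = qmul (a *: x) y.
Proof. by apply: quatP; rewrite !(qcZ, qc_mk, qcZ); ring. Qed.
Lemma qscaleAr a x y : a *: qmul x y = qmul x (a *: y).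
Proof. by apply: quatP; rewrite !(qcZ, qc_mk, qcZ); ring. Qed.

HB.instance Definition _ := GRing.Zmodule_isNzRing.Build (quat b c)
  qmulA qmul1q qmulq1 qmulDl qmulDr qone_neq0.
HB.instance Definition _ :=
  GRing.Lmodule_isLalgebra.Build rat (quat b c) qscaleAl.
HB.instance Definition _ :=
  GRing.Lalgebra_isAlgebra.Build rat (quat b c) qscaleAr.
HB.instance Definition _ := Algebra_isFalgebra.Build rat (quat b c).

Lemma quat_decomp x :
  x = (qc1 x)%:A + qc2 x *: qe2 + qc3 x *: qe3 + qc4 x *: qe4.
Proof. by apply: quatP; rewrite !(qcD, qcZ, qc_mk); ring. Qed.

Lemma qc_lincomb (x1 x2 x3 x4 : rat) :
  let x := x1%:A + x2 *: qe2 + x3 *: qe3 + x4 *: qe4 in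
  [/\ qc1 x = x1, qc2 x = x2, qc3 x = x3 & qc4 x = x4].
Proof. by split; rewrite !(qcD, qcZ, qc_mk); ring. Qed.

Lemma dim_quat : \dim {: quat b c} = 4%N.
Proof. by rewrite dimvf. Qed.

Lemma qe2_sqr : qe2 * qe2 = (- b)%:A.
Proof. by apply: quatP; rewrite !(qcZ, qc_mk); ring. Qed.
Lemma qe3_sqr : qe3 * qe3 = (- c)%:A.
Proof. by apply: quatP; rewrite !(qcZ, qc_mk); ring. Qed.
Lemma qe23 : qe2 * qe3 = qe4.
Proof. by apply: quatP; rewrite !qc_mk; ring. Qed.
Lemma qe32 : qe3 * qe2 = - qe4.
Proof. by rewrite -scaleN1r; apply: quatP; rewrite !(qcZ, qc_mk); ring. Qed.

Definition qnorm x : rat :=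
  qc1 x ^+ 2 + b * qc2 x ^+ 2 + c * qc3 x ^+ 2 + b * c * qc4 x ^+ 2.

End Quaternions.

Definition division_quat (b c : rat) : Prop :=
  forall x : quat b c, qnorm x = 0 -> x = 0.

Definition qconj (b c : rat) (x : quat b c) : quat b c :=
  mkquat b c (qc1 x) (- qc2 x) (- qc3 x) (- qc4 x).

Lemma qmul_conj (b c : rat) (x : quat b c) : x * qconj x = (qnorm x)%:A.
Proof. by apply: quatP; rewrite !(qcZ, qc_mk) /qnorm; ring. Qed.

Lemma qconj_mul (b c : rat) (x : quat b c) : qconj x * x = (qnorm x)%:A.
Proof. by apply: quatP; rewrite !(qcZ, qc_mk) /qnorm; ring. Qed.

(* Consistency with the usual notion of a division algebra. *)
Lemma division_quatP (b c : rat) :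
  division_quat b c <-> forall x : quat b c, x != 0 -> x \is a GRing.unit.
Proof.
split=> [D x x0 | U x nx0].
  have nx : qnorm x != 0 by apply: contra_neq x0 => /D.
  apply/unitrP; exists ((qnorm x)^-1 *: qconj x).
  by rewrite -scalerAl -scalerAr qmul_conj qconj_mul scalerA mulVf // scale1r.
apply/eqP/negPn/negP => x0; have Ux := U x x0.
have cx0 : qconj x = 0.
  by apply: (mulrI Ux); rewrite qmul_conj nx0 scale0r mulr0.
rewrite -(scale0r x) in cx0.
case/eqP: x0; rewrite -(scale0r x); apply: quatP; rewrite qcZ mul0r.
- by have := congr1 (@qc1 b c) cx0; rewrite qc_mk qcZ mul0r.
- by have /eqP := congr1 (@qc2 b c) cx0; rewrite qc_mk qcZ mul0r oppr_eq0 => /eqP.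
- by have /eqP := congr1 (@qc3 b c) cx0; rewrite qc_mk qcZ mul0r oppr_eq0 => /eqP.
- by have /eqP := congr1 (@qc4 b c) cx0; rewrite qc_mk qcZ mul0r oppr_eq0 => /eqP.
Qed.

(* Main.v *)
Require Import Defs.
From mathcomp Require Import all_boot all_order all_algebra.

Import Order.TTheory GRing.Theory Num.Theory.
Local Open Scope ring_scope.

(** For positive [b] and [c] the norm is a diagonal form with coefficients
    [1, b, c, b * c] that are all positive, so it is positive definite: a sum
    of nonnegative terms vanishes only if each of them does. *)
Lemma division_quat_pos (b c : rat) : 0 < b -> 0 < c -> division_quat b c.
Proof.
move=> b0 c0 x; have bc0 : 0 < b * c by rewrite mulr_gt0.
have term_ge0 (a t : rat) : 0 < a -> 0 <= a * t ^+ 2.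
  by move=> a0; rewrite mulr_ge0 ?sqr_ge0 // ltW.
have term_eq0 (a t : rat) : 0 < a -> (a * t ^+ 2 == 0) = (t == 0).
  by move=> a0; rewrite mulf_eq0 sqrf_eq0 gt_eqF.
move=> /eqP; rewrite /qnorm !paddr_eq0 ?addr_ge0 ?sqr_ge0 ?term_ge0 //.
rewrite sqrf_eq0 !term_eq0 // => /andP[/andP[/andP[/eqP x1 /eqP x2] /eqP x3] /eqP x4].
by apply: quatP; rewrite ?x1 ?x2 ?x3 ?x4 /qc1 /qc2 /qc3 /qc4 mxE.
Qed.

Theorem proposition3p5 (b c : rat)
    (hbc : (b, c) \in [:: (1, 1); (1, 2); (1, 3); (2, 2); (2, 3); (2, 4); (2, 5)]) :
  division_quat b c.
Proof.
have /allP/(_ _ hbc)/andP[b0 c0] :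
  all (fun p : rat * rat => (0 < p.1) && (0 < p.2))
    [:: (1, 1); (1, 2); (1, 3); (2, 2); (2, 3); (2, 4); (2, 5)] by [].
exact: division_quat_pos.
Qed.
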